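(* Let $X,Y$ be real Banach spaces and $1<p<\infty$. For any $k_1,k_2,k\in\mathbb{Z}^+$ satisfying $k=k_1+k_2-1$, the following statements hold. (1) If $X$ is $k_1$-WUR and $Y$ is $k_2$-WUR, then $X\oplus_pY$ is $k$-WUR. (2) If $X$ is $k_1$-WLUR and $Y$ is $k_2$-WLUR, then $X\oplus_pY$ is $k$-WLUR. (3) If $X$ is $k_1$-WMLUR and $Y$ is $k_2$-WMLUR, then $X\oplus_pY$ is $k$-WMLUR.
   Context: $X\oplus_pY$ is $X\times Y$ with the norm $\|(x,y)\|=(\|x\|^p+\|y\|^p)^{1/p}$. For a Banach space $Z$ with unit sphere $S_Z$ and dual $Z^*$, $z_1,\dots,z_{k+1}\in Z$ and $f_1,\dots,f_k\in Z^*$, $D_k[(z_i)_{i=1}^{k+1};(f_j)_{j=1}^{k}]$ denotes the determinant of the $(k+1)\times(k+1)$ matrix whose first row consists of ones and whose $(j+1,i)$ entry is $f_j(z_i)$. For $k\in\mathbb{Z}^+$: $Z$ is $k$-WUR ($k$-weakly uniformly rotund) if for every $\epsilon>0$ and $f_1,\dots,f_k\in S_{Z^*}$, $$\inf\Big(\{1\}\cup\Big\{1-\tfrac{1}{k+1}\Big\|\sum_{i=1}^{k+1}z_i\Big\| : z_1,\dots,z_{k+1}\in S_Z,\ |D_k[(z_i)_{i=1}^{k+1};(f_j)_{j=1}^{k}]|\ge\epsilon\Big\}\Big)>0.$$ $Z$ is $k$-WLUR ($k$-weakly locally uniformly rotund) if for every $z\in S_Z$, $\epsilon>0$ and $f_1,\dots,f_k\in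 S_{Z^*}$, $$\inf\Big(\{1\}\cup\Big\{1-\tfrac{1}{k+1}\Big\|z+\sum_{i=1}^{k}z_i\Big\| : z_1,\dots,z_{k}\in S_Z,\ |D_k[z,(z_i)_{i=1}^{k};(f_j)_{j=1}^{k}]|\ge\epsilon\Big\}\Big)>0.$$ $Z$ is $k$-WMLUR ($k$-weakly midpoint locally uniformly rotund) if for any $z\in S_Z$ and any sequences $(z_n^{(1)}),\dots,(z_n^{(k+1)})$ in $S_Z$ with $\|(k+1)z-\sum_{i=1}^{k+1}z_n^{(i)}\|\to0$, it follows that $D_k[(z_n^{(i)})_{i=1}^{k+1};(f_j)_{j=1}^{k}]\to0$ for all $f_1,\dots,f_k\in S_{Z^*}$. *)

(* Defs.v *)
From HB Require Import structures.
From mathcomp Require Import all_boot all_order all_algebra.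
From mathcomp Require Import all_classical all_reals all_analysis.

Set Implicit Arguments.
Unset Strict Implicit.
Unset Printing Implicit Defensive.

Import Order.TTheory GRing.Theory Num.Theory.
Import numFieldNormedType.Exports.

Local Open Scope classical_set_scope.
Local Open Scope ring_scope.

Section LpSum.
Context {R : realType} {p : R}.

(* Alias of [X * Y] carrying the p-norm instead of the sup norm of the library's
   product. [hp] only serves to make the normed space structure below available. *)
Definition lpsum (hp : 1 < p) (X Y : Type) : Type := (X * Y)%type.

Lemma minkowski2 (hp : 1 < p) (a1 a2 b1 b2 : R) :
  0 <= a1 -> 0 <= a2 -> 0 <= b1 -> 0 <= b2 ->
  ((a1 + b1) `^ p + (a2 + b2) `^ p) `^ p^-1 <=
  (a1 `^ p + a2 `^ p) `^ p^-1 + (b1 `^ p + b2 `^ p) `^ p^-1.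
Proof.
move=> a10 a20 b10 b20.
have p0 : 0 < p by exact: lt_trans hp.
pose f a b n : R := match n with 0%nat => a | 1%nat => b | _ => 0 end.
have mf a b : measurable_fun setT (f a b) by [].
have LE a b : 0 <= a -> 0 <= b ->
    Lnorm counting p%:E (EFin \o f a b) = ((a `^ p + b `^ p) `^ p^-1)%:E.
  move=> a0 b0; rewrite Lnorm_counting//.
  rewrite (nneseries_split 0 2); last by move=> k; rewrite lee_fin powR_ge0.
  rewrite ereal_series_cond eseries0 ?adde0; last first.
    by move=> [//|] [//|n _]; rewrite /f /= normr0 powR0// gt_eqF.
  by rewrite add0n big_mkord 2!big_ord_recr /= big_ord0 add0e -EFinD
    poweR_EFin !ger0_norm.
have := minkowski_EFin counting (mf a1 a2) (mf b1 b2) (ltW hp).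
have -> : (f a1 a2 \+ f b1 b2)%R = f (a1 + b1) (a2 + b2).
  by apply/funext => -[//|[//|n]] /=; rewrite addr0.
by rewrite !LE ?addr_ge0// -EFinD lee_fin.
Qed.

Context (hp : 1 < p) (X Y : normedModType R).

HB.instance Definition _ := GRing.Lmodule.copy (lpsum hp X Y) (X * Y)%type.

Definition lpsum_norm (z : lpsum hp X Y) : R :=
  (`|z.1| `^ p + `|z.2| `^ p) `^ p^-1.

Let p_gt0 : 0 < p. Proof. exact: lt_trans hp. Qed.

Let p_neq0 : p != 0. Proof. by rewrite gt_eqF. Qed.

Lemma ler_lpsum_normD (z w : lpsum hp X Y) :
  lpsum_norm (z + w) <= lpsum_norm z + lpsum_norm w.
Proof.
apply: le_trans (minkowski2 _ _ _ _ _) => //.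
rewrite /lpsum_norm ge0_ler_powR ?invr_ge0 ?(ltW p_gt0)// ?nnegrE ?addr_ge0
  ?powR_ge0// lerD// ge0_ler_powR ?(ltW p_gt0)// ?nnegrE ?addr_ge0//;
  exact: ler_normD.
Qed.

Lemma lpsum_normZ (l : R) (z : lpsum hp X Y) :
  lpsum_norm (l *: z) = `|l| * lpsum_norm z.
Proof.
rewrite /lpsum_norm /= !normrZ !powRM// -mulrDr powRM ?addr_ge0 ?powR_ge0//.
by rewrite -powRrM divff// powRr1.
Qed.

Lemma lpsum_norm0_eq0 (z : lpsum hp X Y) : lpsum_norm z = 0 -> z = 0.
Proof.
move=> /powR_eq0_eq0 /eqP; rewrite paddr_eq0 ?powR_ge0// => /andP[].
case: z => x y /= /eqP/powR_eq0_eq0/eqP + /eqP/powR_eq0_eq0/eqP.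
by rewrite !normr_eq0 => /eqP -> /eqP ->.
Qed.

HB.instance Definition _ := Lmodule_isNormed.Build R (lpsum hp X Y)
  ler_lpsum_normD lpsum_normZ lpsum_norm0_eq0.

Lemma lpsum_normE (z : lpsum hp X Y) :
  `|z| = (`|z.1| `^ p + `|z.2| `^ p) `^ p^-1.
Proof. by []. Qed.

Lemma lpsum_norm_fst (z : lpsum hp X Y) : `|z.1| <= `|z|.
Proof.
rewrite lpsum_normE -[leLHS]powRr1// -(divff p_neq0) powRrM.
by rewrite ge0_ler_powR ?invr_ge0 ?(ltW p_gt0)// ?nnegrE ?addr_ge0 ?powR_ge0//
  lerDl powR_ge0.
Qed.

Lemma lpsum_norm_snd (z : lpsum hp X Y) : `|z.2| <= `|z|.
Proof.
rewrite lpsum_normE -[leLHS]powRr1// -(divff p_neq0) powRrM.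
by rewrite ge0_ler_powR ?invr_ge0 ?(ltW p_gt0)// ?nnegrE ?addr_ge0 ?powR_ge0//
  lerDr powR_ge0.
Qed.

Lemma lpsum_norm_le (z : lpsum hp X Y) : `|z| <= `|z.1| + `|z.2|.
Proof.
have := minkowski2 hp (normr_ge0 z.1) (lexx 0) (lexx 0) (normr_ge0 z.2).
by rewrite addr0 add0r powR0// addr0 add0r -!powRrM divff// !powRr1.
Qed.

End LpSum.

Section LpSumComplete.
Context {R : realType} {p : R} (hp : 1 < p) (X Y : completeNormedModType R).

Let lpsum_complete (F : set_system (lpsum hp X Y)) :
  ProperFilter F -> cauchy F -> cvg F.
Proof.
move=> FF /cauchyP Fc.
have /cvg_ex[x Fx] : cvg ((fun z : lpsum hp X Y => z.1) @ F).
  apply: cauchy_cvg; apply: cauchy_exP => e e0; have [z Fz] := Fc _ e0.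
  exists z.1; rewrite /fmapE /=; apply: (@filterS _ F _ _ _ _ Fz) => w.
  rewrite -!ball_normE /=; apply: le_lt_trans.
  exact: (lpsum_norm_fst (z - w)).
have /cvg_ex[y Fy] : cvg ((fun z : lpsum hp X Y => z.2) @ F).
  apply: cauchy_cvg; apply: cauchy_exP => e e0; have [z Fz] := Fc _ e0.
  exists z.2; rewrite /fmapE /=; apply: (@filterS _ F _ _ _ _ Fz) => w.
  rewrite -!ball_normE /=; apply: le_lt_trans.
  exact: (lpsum_norm_snd (z - w)).
apply/cvg_ex; exists ((x, y) : lpsum hp X Y).
apply/cvgrPdist_lt => e e0; have e20 : 0 < e / 2 by rewrite divr_gt0.
near=> z; rewrite (le_lt_trans (lpsum_norm_le _))// (splitr e) ltrD//.
  by near: z; move/cvgrPdist_lt : Fx; exact.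
by near: z; move/cvgrPdist_lt : Fy; exact.
Unshelve. all: by end_near. Qed.

HB.instance Definition _ :=
  Uniform_isComplete.Build (lpsum hp X Y) lpsum_complete.

End LpSumComplete.

Section Duality.
Context {R : realType} (Z : normedModType R).

Definition unit_sphere : set Z := [set z | `|z| = 1].

Definition dual_norm (f : {linear Z -> R^o}) : R :=
  sup [set `|f z| | z in [set z : Z | `|z| <= 1]].

(* [sup] is 0 on unbounded sets, so continuity must be required separately. *)
Definition dual_unit_sphere : set {linear Z -> R^o} :=
  [set f : {linear Z -> R^o} | continuous f /\ dual_norm f = 1].

End Duality.

Section Rotundity.
Context {R : realType} (Z : normedModType R) (k : nat).

Definition Dk (z : 'I_k.+1 -> Z) (f : 'I_k -> {linear Z -> R^o}) : R :=
  \det (col_mx (const_mx 1 : 'rV[R]_k.+1) (\matrix_(j < k, i < k.+1) f j (z i))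
        : 'M[R]_k.+1).

(* The family z, z_1, ..., z_k. *)
Definition cons_family (z : Z) (zs : 'I_k -> Z) : 'I_k.+1 -> Z :=
  fun i => if unlift ord0 i is Some j then zs j else z.

Definition midpoint_defect (z : 'I_k.+1 -> Z) : R :=
  1 - k.+1%:R^-1 * `|\sum_(i < k.+1) z i|.

Definition k_WUR : Prop :=
  forall (eps : R) (f : 'I_k -> {linear Z -> R^o}),
    0 < eps -> (forall j, dual_unit_sphere (f j)) ->
    0 < inf ([set 1] `|`
      [set midpoint_defect z | z in [set z : 'I_k.+1 -> Z |
         (forall i, unit_sphere (z i)) /\ eps <= `|Dk z f|]]).

Definition k_WLUR : Prop :=
  forall (z : Z) (eps : R) (f : 'I_k -> {linear Z -> R^o}),
    unit_sphere z -> 0 < eps -> (forall j, dual_unit_sphere (f j)) ->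
    0 < inf ([set 1] `|`
      [set midpoint_defect (cons_family z zs) | zs in [set zs : 'I_k -> Z |
         (forall i, unit_sphere (zs i)) /\
         eps <= `|Dk (cons_family z zs) f|]]).

Definition k_WMLUR : Prop :=
  forall (z : Z) (zn : 'I_k.+1 -> nat -> Z),
    unit_sphere z -> (forall i n, unit_sphere (zn i n)) ->
    (fun n => `|k.+1%:R *: z - \sum_(i < k.+1) zn i n|) @ \oo --> (0 : R) ->
    forall f : 'I_k -> {linear Z -> R^o}, (forall j, dual_unit_sphere (f j)) ->
      (fun n => Dk (zn^~ n) f) @ \oo --> (0 : R).

End Rotundity.

(* Main.v *)
(* Along an ultrafilter all the bounded quantities at stake converge, so each
   rotundity property says that the limit of a determinant D_k vanishes when the
   norms of the vectors have a common limit a and the norm of their sum tends to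
   (k+1)a. If unit vectors (x_i,y_i) of the p-sum satisfy this, then, by the
   equality case of Minkowski's inequality in R^2, so do the x_i and the y_i
   separately. The limit of the matrix (f_j(z_i - z_0)) is the sum of a matrix
   coming from X and one coming from Y. Rotundity of X makes all k1-minors of the
   first one vanish, so its rank is at most k1-1; likewise the second one has
   rank at most k2-1. The sum has rank at most k1+k2-2 < k and is singular. *)
From HB Require Import structures.
Require Import Defs.
From mathcomp Require Import all_boot all_order all_algebra.
From mathcomp Require Import all_classical all_reals all_analysis.
From mathcomp Require Import ring lra zify.

Set Implicit Arguments.
Unset Strict Implicit.
Unset Printing Implicit Defensive.

Import Order.TTheory GRing.Theory Num.Theory.
Import numFieldNormedType.Exports.

Local Open Scope classical_set_scope.
Local Open Scope ring_scope.

(** * Determinants of difference matrices and rank *)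

Definition diffmx (R : realType) (k : nat) (V : 'I_k -> 'I_k.+1 -> R) : 'M[R]_k :=
  \matrix_(j < k, i < k) (V j (lift ord0 i) - V j ord0).

(** Subtracting the first column of the matrix of [Dk] from the others, here a product with a
    unitriangular block matrix, turns the row of ones into [(1, 0, ..., 0)]. What is left of the
    determinant is the minor of differences to the base vector. *)
Lemma Dk_diffmx (R : realType) (Z : normedModType R) (k : nat)
    (z : 'I_k.+1 -> Z) (f : 'I_k -> {linear Z -> R^o}) :
  Dk z f = \det (diffmx (fun j i => f j (z i))).
Proof.
rewrite /Dk.
set M := (X in col_mx _ X); set A := col_mx _ _.
pose M0 : 'cV[R]_k := \col_j f j (z ord0).
have EA : (A : 'M[R]_(1 + k)) *m block_mx 1%:M (const_mx (-1)) 0 1%:M =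
    block_mx 1%:M 0 M0 (diffmx (fun j i => f j (z i))).
  have -> : (A : 'M[R]_(1 + k)) =
      block_mx 1%:M (const_mx 1) M0 (\matrix_(j, i) f j (z (lift ord0 i))).
    rewrite /A /block_mx; congr col_mx; apply/matrixP => a b; rewrite !mxE.
      by rewrite split1; case: unliftP => [c|] _ /=; rewrite !mxE ?ord1 ?eqxx.
    by rewrite split1; case: unliftP => [c|] -> /=; rewrite !mxE.
  rewrite mulmx_block !mulmx1 !mulmx0 mul1mx !addr0.
  congr block_mx; first by rewrite -raddfD/= addNr; apply/matrixP => a b; rewrite !mxE.
  apply/matrixP => a b; rewrite !mxE big_ord1 !mxE; ring.
have := congr1 determinant EA.
by rewrite det_mulmx det_ublock det_lblock !det1 !mul1r mulr1.
Qed.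

(** If the rank were at least [r], there would be [r] free rows, and among the columns of that
    submatrix [r] independent ones, hence an invertible minor with an injective choice of
    columns. *)
Lemma rank_lt_minors (F : fieldType) (m n r : nat) (A : 'M[F]_(m, n)) :
  (0 < r)%N ->
  (forall (t : 'I_r -> 'I_m) (s : 'I_r -> 'I_n), injective s ->
     \det (mxsub t s A) = 0) -> (\rank A < r)%N.
Proof.
move=> r0 H; rewrite ltnNge; apply/negP => rA.
pose t := maxrankfun A \o widen_ord rA.
(* A relation among [r] rows of a maximal free family becomes, after padding with zeros, a relation
   in the whole family. *)
have tfree : row_free (rowsub t A).
  rewrite rowsub_comp; apply: inj_row_free => v.
  have -> : rowsub (widen_ord rA) (rowsub (maxrankfun A) A) =
      rowsub (widen_ord rA) 1%:M *m rowsub (maxrankfun A) A.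
    by rewrite mul_rowsub_mx mul1mx.
  rewrite mulmxA => /eqP.
  rewrite mulmx_free_eq0 ?maxrowsub_free// => /eqP vW.
  apply/rowP => i; have := congr1 (fun w : 'rV_(\rank A) => w 0 (widen_ord rA i)) vW.
  rewrite !mxE (bigD1 i)//= !mxE eqxx mulr1 big1 ?addr0// => j ji.
  rewrite !mxE (_ : (_ == _) = false) ?mulr0//.
  by apply/negbTE; apply: contra ji => /eqP/(congr1 val)/= /val_inj ->.
have full : row_full (rowsub t A)^T.
  by rewrite /row_full mxrank_tr.
have := fullrowsub_unit full; rewrite unitmxE.
have E : rowsub (fullrankfun full) (rowsub t A)^T = (mxsub t (fullrankfun full) A)^T.
  by apply/matrixP => i j; rewrite !mxE.
by rewrite E det_tr H ?unitr0//; exact: fullrankfun_inj.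
Qed.

(** * Limits of real functions along filters and ultrafilters *)

Section FilterLimits.
Context {R : realType}.

Lemma cvg_sumr (T : Type) (F : set_system T) (I : Type) (r : seq I) (P : pred I)
    (u : I -> T -> R) (l : I -> R) {FF : Filter F} :
  (forall i, P i -> u i @ F --> l i) ->
  (fun t => \sum_(i <- r | P i) u i t) @ F --> \sum_(i <- r | P i) l i.
Proof. by move=> ul; apply: cvg_big => //; exact: add_continuous. Qed.

Lemma cvg_prodr (T : Type) (F : set_system T) (I : Type) (r : seq I) (P : pred I)
    (u : I -> T -> R) (l : I -> R) {FF : Filter F} :
  (forall i, P i -> u i @ F --> l i) ->
  (fun t => \prod_(i <- r | P i) u i t) @ F --> \prod_(i <- r | P i) l i.
Proof. by move=> ul; apply: cvg_big => //; exact: mul_continuous. Qed.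

Lemma cvg_det (T : Type) (F : set_system T) (n : nat) (A : T -> 'M[R]_n)
    (B : 'M[R]_n) {FF : Filter F} :
  (forall i j, (fun t => A t i j) @ F --> B i j) ->
  (fun t => \det (A t)) @ F --> \det B.
Proof.
move=> AB; apply: cvg_sumr => s _.
by apply: cvgM; [exact: cvg_cst|exact: cvg_prodr].
Qed.

Lemma cvgr_inj (T : Type) (F : set_system T) (u : T -> R) (a b : R)
    {FF : ProperFilter F} : u @ F --> a -> u @ F --> b -> a = b.
Proof. by apply: cvg_unique; exact: Rhausdorff. Qed.

Lemma cvgr_dist0 (T : Type) (F : set_system T) (u v : T -> R) (a : R)
    {FF : Filter F} :
  (\forall t \near F, `|u t - a| <= v t) -> v @ F --> 0 -> u @ F --> a.
Proof.
move=> uv v0; apply/cvgrPdist_lt => e e0.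
near=> t; rewrite distrC; apply: (@le_lt_trans _ _ (v t)); first by near: t.
by near: t; exact: (cvgr_lt _ v0).
Unshelve. all: by end_near. Qed.

(** An ultrafilter [G] refining the image filter contains a compact segment and so converges to some
    [l]. If the preimage of a neighbourhood of [l] were not in [F], its complement would be, and [G]
    would contain two disjoint sets. *)
Lemma ultra_cvg (T : Type) (F : set_system T) (u : T -> R) (M : R) :
  UltraFilter F -> (\forall t \near F, `|u t| <= M) -> exists l : R, u @ F --> l.
Proof.
move=> FU uM.
have [G [GU uG]] := ultraFilterLemma (fmap_proper_filter u (ultra_proper (F := F))).
have := @segment_compact R (- M) M; rewrite compact_ultra => /(_ G GU)[|l [_ Gl]].
  by apply: uG; apply: filterS uM => t; rewrite /= in_itv/= -ler_norml.
exists l => A /Gl GA.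
have [//|FC] := in_ultra_setVsetC (u @^-1` A) FU.
have GC : G (~` A) by apply: uG; exact: FC.
by have [x []] := @filter_ex _ G _ _ (@filterI _ G _ _ _ GA GC).
Qed.

End FilterLimits.

(** * Convexity and continuity of the power function *)

Section PowR.
Context {R : realType} (p : R) (hp : 1 < p).

Let p0 : 0 < p. Proof. exact: lt_trans hp. Qed.

(** This is Young's inequality for [t] and [s^(p-1)] with the conjugate exponents [p] and [p/(p-1)],
    multiplied by [p]. *)
Lemma powR_tangent (s t : R) : 0 <= s -> 0 <= t ->
  s `^ p + p * s `^ (p - 1) * (t - s) <= t `^ p.
Proof.
move=> s0 t0.
have q0 : 0 < p / (p - 1) by rewrite divr_gt0// subr_gt0.
have pq : p^-1 + (p / (p - 1))^-1 = 1.
  by rewrite invf_div; field; rewrite gt_eqF.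
have := conjugate_powR t0 (powR_ge0 s (p - 1)) p0 q0 pq.
rewrite -powRrM mulrCA divff ?mulr1 ?subr_eq0 ?gt_eqF// invf_div.
rewrite -(ler_pM2l p0).
have -> : p * (t `^ p / p + s `^ p * ((p - 1) / p)) = t `^ p + (p - 1) * s `^ p.
  by field; rewrite gt_eqF.
rewrite -(mulr_powRB1 s0 p0).
by set A := t `^ p; set C := s `^ (p - 1); lra.
Qed.

(** Strictness comes from squaring the weak inequality at [s = sqrt t]: the square of [1 + p(s-1)]
    exceeds [1 + p(t-1)] by exactly [p(p-1)(s-1)^2]. *)
Lemma bernoulli_strict (t : R) : 0 <= t -> t != 1 -> 1 + p * (t - 1) < t `^ p.
Proof.
have bern s : 0 <= s -> 1 + p * (s - 1) <= s `^ p.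
  by move=> s0; have := powR_tangent ler01 s0; rewrite !powR1 mulr1.
move=> t0 t1; pose s := Num.sqrt t.
have s0 : 0 <= s by exact: sqrtr_ge0.
have ts : t = s ^+ 2 by rewrite sqr_sqrtr.
have s1 : s != 1 by apply: contra t1 => /eqP s1; rewrite ts s1 expr1n.
have tp : t `^ p = (s `^ p) ^+ 2.
  by rewrite ts expr2 powRM// -expr2.
(* Squaring needs a nonnegative left side. If it is negative, then [s < 1], and [1 + p(t-1)] is
   negative as well. *)
have [neg|pos] := ltP (1 + p * (s - 1)) 0.
  apply: lt_le_trans (powR_ge0 _ _); rewrite ts.
  have sl1 : s - 1 < 0 by rewrite -(pmulr_rlt0 _ p0); lra.
  have : p * (s * (s - 1)) <= 0 by rewrite pmulr_rle0// mulr_ge0_le0// ltW.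
  by move: neg; lra.
have : (1 + p * (s - 1)) ^+ 2 <= t `^ p.
  by rewrite tp ler_sqr ?nnegrE ?powR_ge0// bern.
apply: lt_le_trans; rewrite ts.
have : 0 < (p * (p - 1)) * (s - 1) ^+ 2.
  apply: mulr_gt0; first by rewrite mulr_gt0// subr_gt0.
  by rewrite exprn_even_gt0//= subr_eq0.
by lra.
Qed.

(** By homogeneity this is the strict Bernoulli inequality at [t / s]; for [s = 0] the tangent is
    the zero line. *)
Lemma powR_tangent_strict (s t : R) : 0 <= s -> 0 <= t -> t != s ->
  s `^ p + p * s `^ (p - 1) * (t - s) < t `^ p.
Proof.
rewrite le_eqVlt => /predU1P[<-|s0] t0 ts.
  rewrite !powR0 ?gt_eqF// ?subr_gt0// mulr0 mul0r addr0.
  by rewrite powR_gt0// lt_def ts.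
have := @bernoulli_strict (t / s) _ _.
rewrite divr_ge0 ?(ltW s0)// => /(_ isT); rewrite -subr_eq0.
have -> : t / s - 1 = (t - s) / s by field; rewrite gt_eqF.
rewrite mulf_eq0 subr_eq0 (negbTE ts) invr_eq0 gt_eqF// => /(_ isT).
rewrite -(ltr_pM2l (powR_gt0 p s0)) -powRM ?divr_ge0 ?(ltW s0)//.
rewrite (mulrCA s t) divff ?gt_eqF// mulr1.
apply: le_lt_trans.
rewrite -(mulr_powRB1 (ltW s0) p0).
rewrite le_eqVlt; apply/orP; left; apply/eqP.
by set A := s `^ (p - 1); field; rewrite gt_eqF.
Qed.

(** The tangents at [a] and at [u t] bound the difference of powers from both sides. Once
    [u t <= a + 1], both slopes are at most [p(a+1)^(p-1)], which gives a Lipschitz estimate. *)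
Lemma cvg_powR (T : Type) (F : set_system T) (u : T -> R) (a : R)
    {FF : ProperFilter F} : (forall t, 0 <= u t) -> u @ F --> a ->
  (fun t => u t `^ p) @ F --> a `^ p.
Proof.
move=> u0 ua.
have a0 : 0 <= a by apply: (cvgr_to_ge ua); near=> t.
have p1 : 0 <= p - 1 by rewrite subr_ge0 ltW.
apply: (@cvgr_dist0 _ _ _ _ (fun t => p * (a + 1) `^ (p - 1) * `|u t - a|)).
  near=> t.
  have ut : u t <= a + 1 by near: t; apply: (cvgr_le _ ua); rewrite ltrDl.
  have h1 := powR_tangent a0 (u0 t).
  have h2 := powR_tangent (u0 t) a0.
  have h3 : a `^ (p - 1) <= (a + 1) `^ (p - 1).
    by rewrite ge0_ler_powR// ?nnegrE ?addr_ge0// lerDl.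
  have h4 : u t `^ (p - 1) <= (a + 1) `^ (p - 1).
    by rewrite ge0_ler_powR// ?nnegrE ?addr_ge0// u0.
  have h5 := powR_ge0 a (p - 1); have h6 := powR_ge0 (u t) (p - 1).
  move: h1 h2 h3 h4 h5 h6.
  set A := a `^ _; set B := u t `^ _; set C := a `^ _; set D := u t `^ _.
  set E := (a + 1) `^ _ => h1 h2 h3 h4 h5 h6.
  have hC : p * C <= p * E by rewrite ler_pM2l.
  have hD : p * D <= p * E by rewrite ler_pM2l.
  have pC : 0 <= p * C by rewrite mulr_ge0// ltW.
  have pD : 0 <= p * D by rewrite mulr_ge0// ltW.
  rewrite ler_norml; apply/andP; split.
    have : p * C * `|u t - a| <= p * E * `|u t - a| by rewrite ler_wpM2r.
    have : - (p * C * `|u t - a|) <= p * C * (u t - a).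
      by rewrite -mulrN ler_wpM2l// lerNl; rewrite -normrN ler_norm.
    by move: h1; lra.
  have : p * D * `|u t - a| <= p * E * `|u t - a| by rewrite ler_wpM2r.
  have : p * D * (u t - a) <= p * D * `|u t - a| by rewrite ler_wpM2l// ler_norm.
  by move: h2; lra.
rewrite -[0](mulr0 (p * (a + 1) `^ (p - 1))).
apply: cvgM; first exact: cvg_cst.
rewrite -(@normr0 _ R); apply: cvg_norm; rewrite -(subrr a).
by apply: cvgB => //; exact: cvg_cst.
Unshelve. all: by end_near. Qed.

End PowR.

(** * The equality case of Minkowski's inequality in the plane *)

Section Jensen.
Context {R : realType} (p : R) (hp : 1 < p).

(** Summing the tangent inequalities at the mean [c] cancels the linear terms. In case of equality
    every summand [d i] vanishes, which strict convexity allows only if [a i = c]. *)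
Lemma sum_powR_ge (m : nat) (a : 'I_m.+1 -> R) (c : R) :
  (forall i, 0 <= a i) -> m.+1%:R * c = \sum_i a i ->
  m.+1%:R * c `^ p <= \sum_i a i `^ p /\
  (m.+1%:R * c `^ p = \sum_i a i `^ p -> forall i, a i = c).
Proof.
move=> a0 ac.
have c0 : 0 <= c by rewrite -(pmulr_rge0 _ (ltr0Sn R m)) ac sumr_ge0.
pose d i := a i `^ p - (c `^ p + p * c `^ (p - 1) * (a i - c)).
have d0 i : 0 <= d i by rewrite subr_ge0; exact: powR_tangent.
have sd : \sum_i d i = \sum_i a i `^ p - m.+1%:R * c `^ p.
  rewrite sumrB big_split/= -mulr_sumr sumrB -ac !sumr_const !card_ord.
  by rewrite -(mulr_natl c) subrr mulr0 addr0 mulr_natl.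
split; first by rewrite -subr_ge0 -sd sumr_ge0.
move=> E i; apply/eqP/negPn/negP => aic.
have := powR_tangent_strict hp c0 (a0 i) aic.
rewrite -subr_gt0 -/(d i) lt_def => /andP[/eqP + _]; apply.
move: sd; rewrite E subrr => /eqP; rewrite psumr_eq0// => /allP/(_ i).
by rewrite mem_index_enum => /(_ isT)/eqP.
Qed.

(** The power mean inequality holds for the [a i] against [s] and for the [b i] against [t]. The
    last two hypotheses make the sum of the two inequalities an equality, so each one is an
    equality. *)
Lemma minkowski_eq (m : nat) (a b : 'I_m.+1 -> R) (c s t : R) :
  (forall i, 0 <= a i) -> (forall i, 0 <= b i) -> 0 <= c -> 0 <= s -> 0 <= t ->
  s <= \sum_i a i -> t <= \sum_i b i ->
  (forall i, a i `^ p + b i `^ p = c `^ p) ->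
  s `^ p + t `^ p = (m.+1%:R * c) `^ p ->
  (forall i, m.+1%:R * a i = s) /\ (forall i, m.+1%:R * b i = t).
Proof.
move=> a0 b0 c0 s0 t0 sa tb abc stc.
have N0 : 0 < m.+1%:R :> R by [].
have p0 : 0 < p by exact: lt_trans hp.
have mean (w : 'I_m.+1 -> R) r : 0 <= r -> r <= \sum_i w i -> (forall i, 0 <= w i) ->
    m.+1%:R * r `^ p <= m.+1%:R `^ p * \sum_i w i `^ p /\
    (m.+1%:R * r `^ p = m.+1%:R `^ p * \sum_i w i `^ p ->
     forall i, m.+1%:R * w i = r).
  move=> r0 rw w0; pose e := (\sum_i w i) / m.+1%:R.
  have Ne : m.+1%:R * e = \sum_i w i by rewrite mulrC divfK ?gt_eqF.
  have e0 : 0 <= e by rewrite divr_ge0// sumr_ge0.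
  have [J1 J2] := sum_powR_ge w0 Ne.
  have re : r `^ p <= m.+1%:R `^ p * e `^ p.
    by rewrite -powRM// Ne ge0_ler_powR ?nnegrE ?(ltW p0)// sumr_ge0.
  have J3 : m.+1%:R `^ p * (m.+1%:R * e `^ p) <= m.+1%:R `^ p * \sum_i w i `^ p.
    by rewrite ler_pM2l ?powR_gt0.
  have re' : m.+1%:R * r `^ p <= m.+1%:R `^ p * (m.+1%:R * e `^ p).
    by rewrite mulrCA ler_pM2l.
  split; first exact: le_trans re' J3.
  (* Equality collapses the chain of [re'] and [J3]: Jensen's equality case makes each [w i] the
     mean [e], and strict monotonicity of the power gives [r = \sum_i w i]. *)
  move=> E i; rewrite J2.
    rewrite Ne; apply/eqP; rewrite eq_le rw andbT.
    rewrite leNgt; apply/negP => /(gt0_ltr_powR p0).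
    rewrite !nnegrE => /(_ r0 (sumr_ge0 _ (fun i _ => w0 i))).
    rewrite -Ne powRM// ltNge => /negP; apply.
    by rewrite -(ler_pM2l N0) mulrCA E.
  by apply/eqP; rewrite eq_le J1/= -(ler_pM2l (powR_gt0 p N0)) -E.
have [A1 A2] := mean _ _ s0 sa a0; have [B1 B2] := mean _ _ t0 tb b0.
have E : m.+1%:R * s `^ p + m.+1%:R * t `^ p =
    m.+1%:R `^ p * (\sum_i a i `^ p) + m.+1%:R `^ p * \sum_i b i `^ p.
  rewrite -!mulrDr stc -big_split/= (eq_bigr _ (fun i _ => abc i)).
  by rewrite sumr_const card_ord -(mulr_natl (c `^ p)) powRM// mulrCA.
split; [apply: A2|apply: B2]; move: A1 B1 E;
  set x := _ * s `^ p; set y := _ * t `^ p; set z := _ * \sum_i a i `^ p;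
  set w := _ * \sum_i b i `^ p; lra.
Qed.

End Jensen.

(** * The asymptotic form of the three rotundity notions *)

Variant kind := Uniform | Local | Midpoint.

Section AsymptoticRotundity.
Context {R : realType}.

(* The discrete value in the [Local] case makes a limit 0 mean eventual equality. *)
Definition gap (kd : kind) (Z : normedModType R) (z0 : Z) (m : nat)
    (z : 'I_m.+1 -> Z) : R :=
  match kd with
  | Uniform => 0
  | Local => (z ord0 != z0)%:R
  | Midpoint => `|m.+1%:R *: z0 - \sum_i z i|
  end.

(** Asymptotic equality in the triangle inequality for vectors of asymptotically equal norms. *)
Definition aligned (U : set_system nat) (Z : normedModType R) (m : nat)
    (z : 'I_m.+1 -> nat -> Z) (a : R) : Prop :=
  (forall i, (fun n => `|z i n|) @ U --> a) /\
  (fun n => `|\sum_i z i n|) @ U --> m.+1%:R * a.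

(** Neither the vectors nor the functionals are normalised: components of unit vectors and
    restrictions of unit functionals have no prescribed norm. This is what lets the property pass
    between [X], [Y] and their sum. *)
Definition limit_rotund (kd : kind) (Z : normedModType R) (k : nat) : Prop :=
  forall U : set_system nat, UltraFilter U ->
  forall (z0 : Z) (a : R) (z : 'I_k.+1 -> nat -> Z),
  aligned U z a -> (fun n => gap kd z0 (z^~ n)) @ U --> (0 : R) ->
  forall f : 'I_k -> {linear Z -> R^o}, (forall j, continuous (f j)) ->
  forall V : 'I_k -> 'I_k.+1 -> R,
  (forall j i, (fun n => (f j (z i n) : R)) @ U --> V j i) ->
  \det (diffmx V) = 0.

(** The upper bound is the triangle inequality. For the lower bound, the combination is the full sum
    minus one with weights [1 - l i], whose norm is asymptotically at most [m a], leaving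
    [(m+1) a - m a = a]. *)
Lemma aligned_convex (U : set_system nat) (Z : normedModType R) (m : nat)
    (z : 'I_m.+1 -> nat -> Z) (a : R) (l : 'I_m.+1 -> R) :
  ProperFilter U -> aligned U z a ->
  (forall i, 0 <= l i) -> \sum_i l i = 1 ->
  (fun n => `|\sum_i l i *: z i n|) @ U --> a.
Proof.
move=> FU [za sza] l0 l1.
have ll1 i : l i <= 1 by rewrite -l1 (bigD1 i)//= lerDl sumr_ge0.
apply: (@squeeze_cvgr _ _ _ _
  (fun n => `|\sum_i z i n| - \sum_i (1 - l i) * `|z i n|)
  (fun n => \sum_i l i * `|z i n|)).
- apply: nearW => n; apply/andP; split.
    rewrite lerBlDr (_ : \sum_i z i n =
      \sum_i l i *: z i n + \sum_i (1 - l i) *: z i n).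
      apply: le_trans (ler_normD _ _) _; rewrite lerD2l.
      apply: le_trans (ler_norm_sum _ _ _) _; apply: ler_sum => i _.
      by rewrite normrZ ger0_norm// subr_ge0.
    by rewrite -big_split/=; apply: eq_bigr => i _; rewrite -scalerDl addrC subrK scale1r.
  apply: le_trans (ler_norm_sum _ _ _) _; apply: ler_sum => i _.
  by rewrite normrZ ger0_norm.
- have -> : a = m.+1%:R * a - \sum_i (1 - l i) * a.
    by rewrite -mulr_suml sumrB l1 sumr_const card_ord; ring.
  apply: cvgB => //; apply: cvg_sumr => i _; apply: cvgM => //; exact: cvg_cst.
- have -> : a = \sum_i l i * a by rewrite -mulr_suml l1 mul1r.
  by apply: cvg_sumr => i _; apply: cvgM => //; exact: cvg_cst.
Qed.

(** The minor involves [k1 + 1] of the vectors: the base vector and those selected by [s]. Rotundity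
    of [X] is applied to convex combinations [u i] of the whole family, which stay aligned and whose
    differences are [c] times those of the selected vectors. *)
Lemma limit_rotund_minor (kd : kind) (X : normedModType R) (k1 k : nat)
    (U : set_system nat) (x0 : X) (a : R) (x : 'I_k.+1 -> nat -> X)
    (f : 'I_k -> {linear X -> R^o}) (V : 'I_k -> 'I_k.+1 -> R)
    (t s : 'I_k1 -> 'I_k) :
  limit_rotund kd X k1 -> UltraFilter U ->
  aligned U x a -> (fun n => gap kd x0 (x^~ n)) @ U --> (0 : R) ->
  (forall j, continuous (f j)) ->
  (forall j i, (fun n => (f j (x i n) : R)) @ U --> V j i) ->
  injective s -> \det (mxsub t s (diffmx V)) = 0.
Proof.
move=> rX FU xa xgap fc fV sinj.
pose s' (i : 'I_k1.+1) : 'I_k.+1 :=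
  if unlift ord0 i is Some j then lift ord0 (s j) else ord0.
have s'0 : s' ord0 = ord0 by rewrite /s' unlift_none.
have s'l j : s' (lift ord0 j) = lift ord0 (s j) by rewrite /s' liftK.
have s'inj : injective s'.
  move=> i j; case: (unliftP ord0 i) => [i'|] ->; case: (unliftP ord0 j) => [j'|] ->;
    rewrite ?s'0 ?s'l//.
  by move=> /lift_inj/sinj ->.
pose out l := ~~ [exists i, s' i == l].
pose N : R := k.+1%:R; pose N1 : R := k1.+1%:R.
have N0 : N != 0 by rewrite pnatr_eq0.
have N10 : N1 != 0 by rewrite pnatr_eq0.
(* For midpoint rotundity the vectors outside the selected subfamily have to be
   spread over its members to preserve the barycenter. *)
pose c : R := if kd is Midpoint then N1 / N else 1.
pose d : R := if kd is Midpoint then N^-1 else 0.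
have c0 : c != 0 by rewrite /c; case: (kd); rewrite ?oner_eq0// mulf_neq0 ?invr_eq0.
have cge0 : 0 <= c by rewrite /c; case: (kd); rewrite ?ler01// divr_ge0.
have dge0 : 0 <= d by rewrite /d; case: (kd); rewrite ?lexx// invr_ge0.
pose lam (i : 'I_k1.+1) (l : 'I_k.+1) : R := c * (l == s' i)%:R + d * (out l)%:R.
have lam0 i l : 0 <= lam i l by rewrite addr_ge0// mulr_ge0.
have delta (b : 'I_k.+1) : \sum_(l < k.+1) (l == b)%:R = 1 :> R.
  by rewrite (bigD1 b)//= eqxx big1 ?addr0// => l /negbTE ->.
(* Each index is either hit by the injective [s'] exactly once or lies outside its image. *)
have K l : \sum_i (l == s' i)%:R + (out l)%:R = 1 :> R.
  rewrite /out; have [/existsP[i /eqP il]|/existsPn nl] := boolP [exists i, s' i == l].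
    rewrite addr0 (bigD1 i)//= il eqxx big1 ?addr0// => j ji.
    by rewrite -il (inj_eq s'inj) eq_sym (negbTE ji).
  by rewrite big1 ?add0r// => i _; rewrite eq_sym (negbTE (nl i)).
have outE : \sum_l (out l)%:R = N - N1 :> R.
  have : \sum_l (\sum_i (l == s' i)%:R + (out l)%:R) = N :> R.
    by rewrite (eq_bigr _ (fun l _ => K l)) sumr_const card_ord.
  rewrite big_split/= exchange_big/= (eq_bigr _ (fun i _ => delta (s' i))).
  by rewrite sumr_const card_ord -/N1 => <-; rewrite addrAC subrr add0r.
have lam1 i : \sum_l lam i l = 1.
  rewrite big_split/= -!mulr_sumr delta outE /c /d; case: (kd); first by ring.
    by ring.
  by field.
pose u (i : 'I_k1.+1) n := \sum_l lam i l *: x l n.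
have sumu n : \sum_i u i n = \sum_l (\sum_i lam i l) *: x l n.
  by rewrite exchange_big/=; apply: eq_bigr => l _; rewrite scaler_suml.
have ua : aligned U u a.
  split=> [i|]; first exact: aligned_convex.
  (* The sum of the [u i] is [N1] times a convex combination of the [x l], so the convexity lemma
     applies again. *)
  have E n : `|\sum_i u i n| = N1 * `|\sum_l (N1^-1 * \sum_i lam i l) *: x l n|.
    transitivity `|N1 *: \sum_l (N1^-1 * \sum_i lam i l) *: x l n|; last first.
      by rewrite normrZ ger0_norm.
    rewrite scaler_sumr sumu; congr `|_|; apply: eq_bigr => l _.
    by rewrite scalerA mulrA divff ?mul1r.
  under eq_fun do rewrite E.
  apply: cvgM; first exact: cvg_cst.
  apply: aligned_convex => // [l|]; first by rewrite mulr_ge0 ?invr_ge0// sumr_ge0.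
  rewrite -mulr_sumr exchange_big/= (eq_bigr _ (fun i _ => lam1 i)).
  by rewrite sumr_const card_ord mulVf.
have ugap : (fun n => gap kd x0 (u^~ n)) @ U --> (0 : R).
  rewrite /gap in xgap *; case: (kd) @c @d @lam @u xgap {c0 cge0 dge0 lam0 lam1 ua}
    sumu => c d lam u xgap sumu; first exact: cvg_cst.
    rewrite (_ : (fun n => _) = (fun n => (x ord0 n != x0)%:R))//.
    apply/funext => n; congr ((_ != _)%:R).
    (* In the [Local] case [s'] fixes the base index and the weights are 0 or 1, so [u] starts with
       the same vector as [x]. *)
    rewrite /u (bigD1 ord0)//= big1 => [|l l0]; rewrite /lam/c/d s'0.
      by rewrite eqxx mul0r mulr1 !addr0 scale1r.
    by rewrite (negbTE l0) mulr0 mul0r addr0 scale0r.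
  (* In the [Midpoint] case every [l], selected or not, receives the total weight [N1 / N], so both
     families have the same barycenter. *)
  have E n : `|N1 *: x0 - \sum_i u i n| = N1 / N * `|N *: x0 - \sum_i x i n|.
    transitivity `|(N1 / N) *: (N *: x0 - \sum_i x i n)|; last first.
      by rewrite normrZ ger0_norm// divr_ge0.
    rewrite scalerBr scalerA divfK//; congr `|_ - _|.
    rewrite sumu scaler_sumr; apply: eq_bigr => l _.
    congr (_ *: _); rewrite big_split/= -mulr_sumr sumr_const card_ord -/N1.
    rewrite -[d * _ *+ _]mulr_natl -/N1 (canRL (addrK _) (K l)) /c/d /=.
    by ring.
  under eq_fun do rewrite E.
  rewrite -[0](mulr0 (N1 / N)); apply: cvgM => //; exact: cvg_cst.
pose W (j : 'I_k1) (i : 'I_k1.+1) := \sum_l lam i l * V (t j) l.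
have := rX U FU x0 a u ua ugap (f \o t) (fun j => fc (t j)) W.
(* The weights on the outside vectors do not depend on [i] and cancel in the differences, leaving
   the factor [c]. *)
have -> : diffmx W = c *: mxsub t s (diffmx V).
  apply/matrixP => j i; rewrite !mxE /W -sumrB.
  have F (b : 'I_k.+1) : \sum_l (l == b)%:R * V (t j) l = V (t j) b.
    rewrite (bigD1 b)//= eqxx mul1r big1 ?addr0// => l /negbTE ->.
    by rewrite mul0r.
  rewrite -{1}(F (lift ord0 (s i))) -{1}(F ord0) -sumrB mulr_sumr.
  by apply: eq_bigr => l _; rewrite /lam s'0 s'l; ring.
rewrite detZ => /(_ _)/eqP.
rewrite mulf_eq0 expf_eq0 (negbTE c0) andbF/= => H; apply/eqP/H => j i.
rewrite /W (_ : (fun n => _) = (fun n => \sum_l lam i l * (f (t j) (x l n) : R))).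
  by apply: cvg_sumr => l _; apply: cvgM => //; exact: cvg_cst.
by apply/funext => n /=; rewrite linear_sum; apply: eq_bigr => l _; rewrite linearZ.
Qed.

End AsymptoticRotundity.

(** * Passage of asymptotic rotundity to the p-sum *)

Section LpSumRotund.
Context {R : realType}.

Lemma continuous_linear_norm_le (Z : normedModType R) (f : {linear Z -> R^o}) :
  continuous f -> exists2 M, 0 <= M & forall x, `|f x : R| <= M * `|x|.
Proof.
move=> fc; have := continuous_linear_bounded 0 (fc 0).
move=> /linear_boundedP /pinfty_ex_gt0 [M M0 fM].
by exists M; [exact: ltW|exact: fM].
Qed.

Lemma ultra_cvg_linear (Z : normedModType R) (T : Type) (U : set_system T)
    (f : {linear Z -> R^o}) (u : T -> Z) (M : R) :
  UltraFilter U -> continuous f -> (\forall n \near U, `|u n| <= M) ->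
  exists l : R, (fun n => (f (u n) : R)) @ U --> l.
Proof.
move=> FU /continuous_linear_norm_le[N N0 fN] uM.
apply: (@ultra_cvg _ _ _ _ (N * M)); apply: filterS uM => n un.
by apply: le_trans (fN _) _; rewrite ler_wpM2l.
Qed.

Lemma det_diffmxD_eq0 (k k1 k2 : nat) (V W : 'I_k -> 'I_k.+1 -> R) :
  (0 < k1)%N -> (0 < k2)%N -> k = (k1 + k2 - 1)%N ->
  (forall t s : 'I_k1 -> 'I_k, injective s -> \det (mxsub t s (diffmx V)) = 0) ->
  (forall t s : 'I_k2 -> 'I_k, injective s -> \det (mxsub t s (diffmx W)) = 0) ->
  \det (diffmx (fun j i => V j i + W j i)) = 0.
Proof.
move=> k10 k20 kE V0 W0.
have -> : diffmx (fun j i => V j i + W j i) = diffmx V + diffmx W.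
  by apply/matrixP => j i; rewrite !mxE; ring.
have rV := rank_lt_minors k10 V0; have rW := rank_lt_minors k20 W0.
apply/eqP/negPn/negP => d0.
have : diffmx V + diffmx W \in unitmx by rewrite unitmxE unitfE.
rewrite -row_free_unit -row_leq_rank => kr.
(* The ranks add up to at most [k1 + k2 - 2], one less than [k]. *)
have := leq_trans kr (mxrank_add _ _); lia.
Qed.

Context (p : R) (hp : 1 < p) (X Y : normedModType R).

Let p0 : 0 < p. Proof. exact: lt_trans hp. Qed.

Local Notation Z := (lpsum hp X Y).

(** Composing a functional on the p-sum with the two embeddings gives its restrictions to [X] and
    [Y]. *)
Definition lpsum_inl (x : X) : Z := (x, 0).
Definition lpsum_inr (y : Y) : Z := (0, y).

Fact lpsum_inl_linear : linear lpsum_inl.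
Proof. by move=> a x y; apply/pair_equal_spec; rewrite /= scaler0 addr0. Qed.

Fact lpsum_inr_linear : linear lpsum_inr.
Proof. by move=> a x y; apply/pair_equal_spec; rewrite /= scaler0 addr0. Qed.

HB.instance Definition _ := GRing.isLinear.Build R X Z _ lpsum_inl lpsum_inl_linear.
HB.instance Definition _ := GRing.isLinear.Build R Y Z _ lpsum_inr lpsum_inr_linear.

Lemma lpsum_inlr (z : Z) : z = lpsum_inl z.1 + lpsum_inr z.2.
Proof. by case: z => x y; apply/pair_equal_spec; rewrite /= addr0 add0r. Qed.

Lemma lpsum_inl_continuous : continuous lpsum_inl.
Proof.
move=> x; apply/cvgrPdist_lt => e e0; near=> y.
rewrite -linearB; apply: le_lt_trans (lpsum_norm_le _) _; rewrite /= normr0 addr0.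
by near: y; exact: cvgr_dist_lt.
Unshelve. all: by end_near. Qed.

Lemma lpsum_inr_continuous : continuous lpsum_inr.
Proof.
move=> x; apply/cvgrPdist_lt => e e0; near=> y.
rewrite -linearB; apply: le_lt_trans (lpsum_norm_le _) _; rewrite /= normr0 add0r.
by near: y; exact: cvgr_dist_lt.
Unshelve. all: by end_near. Qed.

Lemma lpsum_sum1 (I : finType) (z : I -> Z) : (\sum_i z i).1 = \sum_i (z i).1.
Proof. by apply: (big_morph (fun w : Z => w.1)). Qed.

Lemma lpsum_sum2 (I : finType) (z : I -> Z) : (\sum_i z i).2 = \sum_i (z i).2.
Proof. by apply: (big_morph (fun w : Z => w.2)). Qed.

Lemma lpsum_norm_powR (z : Z) : `|z| `^ p = `|z.1| `^ p + `|z.2| `^ p.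
Proof.
by rewrite lpsum_normE -powRrM mulVf ?gt_eqF// powRr1// addr_ge0 ?powR_ge0.
Qed.

(** Boundedness gives limits of all component norms along the ultrafilter. These limits realise
    equality in Minkowski's inequality, so they do not depend on the index, in either component. *)
Lemma aligned_lpsum (U : set_system nat) (m : nat) (z : 'I_m.+1 -> nat -> Z) (c : R) :
  UltraFilter U -> aligned U z c ->
  (exists a, aligned U (fun i n => (z i n).1) a) /\
  (exists b, aligned U (fun i n => (z i n).2) b).
Proof.
move=> FU [zc szc].
have bnd (u : nat -> Z) (l : R) : (fun n => `|u n|) @ U --> l ->
    \forall n \near U, `|u n| <= l + 1.
  by move=> ul; apply: (cvgr_le _ ul); rewrite ltrDl.
have lim1 (u : nat -> Z) (l : R) : (fun n => `|u n|) @ U --> l ->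
    exists a : R, (fun n => `|(u n).1|) @ U --> a.
  move=> ul0; have ul := bnd _ _ ul0.
  apply: (@ultra_cvg _ _ _ _ (l + 1)); apply: filterS ul => n.
  by rewrite normr_id; apply: le_trans; exact: lpsum_norm_fst.
have lim2 (u : nat -> Z) (l : R) : (fun n => `|u n|) @ U --> l ->
    exists a : R, (fun n => `|(u n).2|) @ U --> a.
  move=> ul0; have ul := bnd _ _ ul0.
  apply: (@ultra_cvg _ _ _ _ (l + 1)); apply: filterS ul => n.
  by rewrite normr_id; apply: le_trans; exact: lpsum_norm_snd.
have lim_ge0 (V : normedModType R) (u : nat -> V) (l : R) :
    (fun n => `|u n|) @ U --> l -> 0 <= l.
  by move=> ul; apply: (cvgr_to_ge ul); exact: nearW.
have powE (u : nat -> Z) (l a b : R) : (fun n => `|u n|) @ U --> l ->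
    (fun n => `|(u n).1|) @ U --> a -> (fun n => `|(u n).2|) @ U --> b ->
    a `^ p + b `^ p = l `^ p.
  move=> ul ua ub; refine (cvgr_inj _ (cvg_powR hp (fun n => normr_ge0 (u n)) ul)).
  under eq_fun do rewrite lpsum_norm_powR.
  by apply: cvgD; exact: cvg_powR.
have [a za] := choice (fun i => lim1 _ _ (zc i)).
have [b zb] := choice (fun i => lim2 _ _ (zc i)).
have [s zs] := lim1 _ _ szc; have [t zt] := lim2 _ _ szc.
(* In the limit [s^p + t^p = ((m+1)c)^p], while [s] and [t] will be seen to be at most the sums of
   the [a i] and of the [b i]. *)
have E := powE _ _ _ _ szc zs zt.
have {}zs : (fun n => `|\sum_i (z i n).1|) @ U --> s.
  by under eq_fun do rewrite -lpsum_sum1.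
have {}zt : (fun n => `|\sum_i (z i n).2|) @ U --> t.
  by under eq_fun do rewrite -lpsum_sum2.
have sa : s <= \sum_i a i.
  have sz : (fun n => \sum_i `|(z i n).1|) @ U --> \sum_i a i.
    by apply: cvg_sumr => i _; exact: za.
  apply: ler_cvg_to zs sz _; apply: nearW => n; exact: ler_norm_sum.
have tb : t <= \sum_i b i.
  have sz : (fun n => \sum_i `|(z i n).2|) @ U --> \sum_i b i.
    by apply: cvg_sumr => i _; exact: zb.
  apply: ler_cvg_to zt sz _; apply: nearW => n; exact: ler_norm_sum.
have [A B] := minkowski_eq hp (fun i => lim_ge0 _ _ _ (za i))
  (fun i => lim_ge0 _ _ _ (zb i)) (lim_ge0 _ _ _ (zc ord0)) (lim_ge0 _ _ _ zs)
  (lim_ge0 _ _ _ zt) sa tb (fun i => powE _ _ _ _ (zc i) (za i) (zb i)) E.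
have N0 : m.+1%:R != 0 :> R by rewrite pnatr_eq0.
split; [exists (a ord0)|exists (b ord0)]; split=> [i|].
- by rewrite (mulfI N0 (etrans (A ord0) (esym (A i)))).
- by rewrite A.
- by rewrite (mulfI N0 (etrans (B ord0) (esym (B i)))).
- by rewrite B.
Qed.

Lemma gap_fst_le (kd : kind) (m : nat) (z0 : Z) (z : 'I_m.+1 -> Z) :
  0 <= gap kd z0.1 (fun i => (z i).1) <= gap kd z0 z.
Proof.
case: kd; rewrite /gap ?lexx ?ler0n ?normr_ge0//=.
  by have [->|_] := eqVneq (z ord0) z0; rewrite ?eqxx ?lexx// ler_nat leq_b1.
by rewrite -lpsum_sum1; exact: (lpsum_norm_fst (m.+1%:R *: z0 - \sum_i z i)).
Qed.

Lemma gap_snd_le (kd : kind) (m : nat) (z0 : Z) (z : 'I_m.+1 -> Z) :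
  0 <= gap kd z0.2 (fun i => (z i).2) <= gap kd z0 z.
Proof.
case: kd; rewrite /gap ?lexx ?ler0n ?normr_ge0//=.
  by have [->|_] := eqVneq (z ord0) z0; rewrite ?eqxx ?lexx// ler_nat leq_b1.
by rewrite -lpsum_sum2; exact: (lpsum_norm_snd (m.+1%:R *: z0 - \sum_i z i)).
Qed.

Lemma limit_rotund_lpsum (kd : kind) (k1 k2 k : nat) :
  (0 < k1)%N -> (0 < k2)%N -> k = (k1 + k2 - 1)%N ->
  limit_rotund kd X k1 -> limit_rotund kd Y k2 -> limit_rotund kd Z k.
Proof.
move=> k10 k20 kE rX rY U FU z0 c z zc zgap f fc V fV.
have [[a xa] [b yb]] := aligned_lpsum FU zc.
pose g j : {linear X -> R^o} := f j \o lpsum_inl.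
pose h j : {linear Y -> R^o} := f j \o lpsum_inr.
have gc j : continuous (g j).
  move=> x; apply: continuous_comp; [exact: lpsum_inl_continuous|exact: fc].
have hc j : continuous (h j).
  move=> x; apply: continuous_comp; [exact: lpsum_inr_continuous|exact: fc].
have xgap : (fun n => gap kd z0.1 (fun i => (z i n).1)) @ U --> (0 : R).
  apply: (@squeeze_cvgr _ _ _ _ (cst 0) _ _ _ _ _ zgap); last exact: cvg_cst.
  by apply: nearW => n; exact: gap_fst_le.
have ygap : (fun n => gap kd z0.2 (fun i => (z i n).2)) @ U --> (0 : R).
  apply: (@squeeze_cvgr _ _ _ _ (cst 0) _ _ _ _ _ zgap); last exact: cvg_cst.
  by apply: nearW => n; exact: gap_snd_le.
have /choice[G Gc] : forall ji : 'I_k * 'I_k.+1, exists l : R,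
    (fun n => (g ji.1 (z ji.2 n).1 : R)) @ U --> l.
  move=> [j i]; apply: (@ultra_cvg_linear _ _ _ (g j) (fun n => (z i n).1) (a + 1)) => //.
  by apply: (cvgr_le _ (xa.1 i)); rewrite ltrDl.
have /choice[H Hc] : forall ji : 'I_k * 'I_k.+1, exists l : R,
    (fun n => (h ji.1 (z ji.2 n).2 : R)) @ U --> l.
  move=> [j i]; apply: (@ultra_cvg_linear _ _ _ (h j) (fun n => (z i n).2) (b + 1)) => //.
  by apply: (cvgr_le _ (yb.1 i)); rewrite ltrDl.
(* Since [f j (x, y) = g j x + h j y], uniqueness of limits splits the limit matrix into a part from
   [X] and a part from [Y]. *)
have -> : V = (fun j i => G (j, i) + H (j, i)).
  apply/funext => j; apply/funext => i; apply: cvgr_inj (fV j i) _.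
  rewrite (_ : (fun n => _) =
    (fun n => (g j (z i n).1 : R) + (h j (z i n).2 : R))).
    by apply: cvgD; [exact: (Gc (j, i))|exact: (Hc (j, i))].
  by apply/funext => n; rewrite {1}(lpsum_inlr (z i n)) linearD.
apply: (@det_diffmxD_eq0 _ _ _ (fun j i => G (j, i)) (fun j i => H (j, i)) k10 k20 kE)
  => t s sinj.
  exact: (@limit_rotund_minor _ kd X k1 k U z0.1 a (fun i n => (z i n).1) g
    (fun j i => G (j, i)) t s rX FU xa xgap gc (fun j i => Gc (j, i)) sinj).
exact: (@limit_rotund_minor _ kd Y k2 k U z0.2 b (fun i n => (z i n).2) h
  (fun j i => H (j, i)) t s rY FU yb ygap hc (fun j i => Hc (j, i)) sinj).
Qed.

End LpSumRotund.

(** * Equivalence of the original definitions with the asymptotic form *)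

Section EpsilonDelta.
Context {R : realType}.

(** The point 1 makes the set nonempty and 0 bounds it below, so [inf] is a genuine greatest lower
    bound rather than a default value. *)
Lemma inf_1U_gt0 (E : set R) : (forall x, E x -> 0 <= x) ->
  0 < inf ([set 1] `|` E) <-> exists2 d, 0 < d & forall x, E x -> d <= x.
Proof.
move=> E0; split=> [i0|[d d0 dE]].
  exists (inf ([set 1] `|` E)) => // x Ex.
  apply: ge_inf; last by right.
  by exists 0 => y [->|/E0//]; exact: ler01.
apply: (@lt_le_trans _ _ (Num.min 1 d)); first by rewrite lt_min ltr01.
apply: lb_le_inf; first by exists 1; left.
by move=> y [->|/dE dy]; rewrite ge_min ?lexx// dy orbT.
Qed.

(** The constant [c] is the dual norm of [f]. If it is 0 then [f] vanishes; otherwise [f] divided by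
    [c] has dual norm 1. *)
Lemma dual_normalize (Z : normedModType R) (f : {linear Z -> R^o}) :
  continuous f -> (forall x, f x = 0) \/
  exists g c, [/\ dual_unit_sphere g, c != 0 & forall x, (f x : R) = c * g x].
Proof.
move=> fc; have [M M0 fM] := continuous_linear_norm_le fc.
(* A bounded nonempty set of values ensures that the [sup] in [dual_norm] is a true supremum. *)
have suph (g : {linear Z -> R^o}) N : 0 <= N -> (forall x, `|g x : R| <= N * `|x|) ->
    has_sup [set `|g x : R| | x in [set x : Z | `|x| <= 1]].
  move=> N0 gN; split; first by exists `|g 0 : R|, 0; rewrite //= normr0.
  exists N => _ [x /= x1 <-]; apply: le_trans (gN x) _.
  by rewrite -[leRHS]mulr1 ler_wpM2l.
pose c : R := dual_norm f.
have fle x : `|x| <= 1 -> `|f x : R| <= c.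
  by move=> x1; apply: (sup_upper_bound (suph _ _ M0 fM)); exists x.
have c0 : 0 <= c by apply: le_trans (fle 0 _); rewrite ?normr0.
have fcx x : `|f x : R| <= c * `|x|.
  have [->|x0] := eqVneq x 0; first by rewrite linear0 !normr0 mulr0.
  rewrite -ler_pdivrMr ?normr_gt0//.
  have := fle (`|x|^-1 *: x); rewrite normrZ normfV normr_id mulVf ?normr_eq0//.
  rewrite linearZ/= => /(_ (lexx _)); rewrite [_ *: _]/(_ * _) normrM normfV normr_id.
  by rewrite mulrC.
have [cz|cnz] := eqVneq c 0.
  left=> x; apply/eqP; rewrite -normr_eq0 eq_le normr_ge0 andbT.
  by have := fcx x; rewrite cz mul0r.
right; exists (c^-1 \*: f), c; split=> //; last first.
  by move=> x /=; rewrite [_ *: _]/(_ * _) mulrA divff// mul1r.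
have gE x : `|(c^-1 \*: f : {linear Z -> R^o}) x : R| = c^-1 * `|f x : R|.
  by rewrite /= [_ *: _]/(_ * _) normrM ger0_norm ?invr_ge0.
have gle x : `|(c^-1 \*: f : {linear Z -> R^o}) x : R| <= 1 * `|x|.
  by rewrite gE ler_pdivrMl ?lt_def ?cnz// mul1r.
split.
  by move=> x; apply: (@cvgM _ _ (nbhs x) _ (cst c^-1)); [exact: cvg_cst|exact: fc].
have gs := suph _ _ ler01 gle.
apply/eqP; rewrite eq_le; apply/andP; split.
  apply: ge_sup; first by case: gs.
  by move=> _ [x /= x1 <-]; apply: le_trans (gle x) _; rewrite mul1r.
rewrite -(ler_pM2l (_ : 0 < c)) ?lt_def ?cnz// mulr1.
apply: ge_sup; first by case: (suph _ _ M0 fM).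
move=> _ [x /= x1 <-]; rewrite -ler_pdivrMl ?lt_def ?cnz// -gE.
by apply: (sup_upper_bound gs); exists x.
Qed.

(** An epsilon-delta form common to the three notions, halfway between the definitions by infima or
    sequences and the asymptotic one. *)
Definition rotund (kd : kind) (Z : normedModType R) (k : nat) : Prop :=
  forall (z0 : Z) (eps : R) (f : 'I_k -> {linear Z -> R^o}),
  (kd <> Uniform -> `|z0| = 1) -> 0 < eps ->
  (forall j, dual_unit_sphere (f j)) ->
  exists2 d : R, 0 < d & forall z : 'I_k.+1 -> Z,
    (forall i, `|z i| = 1) -> midpoint_defect z < d -> gap kd z0 z < d ->
    `|Dk z f| < eps.

Lemma midpoint_defect_ge0 (Z : normedModType R) (k : nat) (z : 'I_k.+1 -> Z) :
  (forall i, `|z i| = 1) -> 0 <= midpoint_defect z.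
Proof.
move=> z1; rewrite subr_ge0 ler_pdivrMl ?ltr0Sn// mulr1.
apply: le_trans (ler_norm_sum _ _ _) _.
by rewrite (eq_bigr _ (fun i _ => z1 i)) sumr_const card_ord.
Qed.

Lemma k_WUR_rotund (Z : normedModType R) (k : nat) :
  k_WUR Z k <-> rotund Uniform Z k.
Proof.
split=> H.
  move=> z0 eps f _ e0 fS.
  have /inf_1U_gt0[|d d0 dH] := H _ f e0 fS.
    by move=> _ [z [z1 _] <-]; exact: midpoint_defect_ge0.
  exists d => // z z1 zd _; rewrite ltNge; apply/negP => De.
  by move: zd; rewrite ltNge => /negP; apply; apply: dH; exists z.
move=> eps f e0 fS; apply/inf_1U_gt0.
  by move=> _ [z [z1 _] <-]; exact: midpoint_defect_ge0.
have [//|d d0 dH] := H 0 _ f _ e0 fS.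
exists d => // _ [z [z1 De] <-]; rewrite leNgt; apply/negP => zd.
by move: De; rewrite leNgt => /negP; apply; exact: dH.
Qed.

Lemma cons_familyK (Z : normedModType R) (k : nat) (z : 'I_k.+1 -> Z) :
  cons_family (z ord0) (z \o lift ord0) = z.
Proof.
by apply/funext => i; rewrite /cons_family; case: unliftP => [j ->|->].
Qed.

Lemma cons_family_norm (Z : normedModType R) (k : nat) (z : Z) (zs : 'I_k -> Z) :
  `|z| = 1 -> (forall i, `|zs i| = 1) -> forall i, `|cons_family z zs i| = 1.
Proof. by move=> z1 zs1 i; rewrite /cons_family; case: unliftP. Qed.

Lemma k_WLUR_rotund (Z : normedModType R) (k : nat) :
  k_WLUR Z k <-> rotund Local Z k.
Proof.
split=> H.
  move=> z0 eps f z01 e0 fS; have {}z01 : `|z0| = 1 by exact: z01.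
  have /inf_1U_gt0[|d d0 dH] := H _ _ f z01 e0 fS.
    move=> _ [zs [zs1 _] <-]; apply: midpoint_defect_ge0.
    exact: cons_family_norm.
  (* The bound 1 on the 0-1 valued [gap] forces the first vector to be [z0]. *)
  exists (Num.min d 1); first by rewrite lt_min d0 ltr01.
  move=> z z1; rewrite !lt_min => /andP[zd _] /andP[_ /=].
  have [zz0 _|_] := eqVneq (z ord0) z0; last by rewrite ltxx.
  rewrite ltNge; apply/negP => De.
  move: zd; rewrite ltNge => /negP; apply; apply: dH.
  exists (z \o lift ord0); last by rewrite -zz0 cons_familyK.
  by split=> [i|]; [exact: z1|rewrite -zz0 cons_familyK].
move=> z0 eps f z01 e0 fS; apply/inf_1U_gt0.
  move=> _ [zs [zs1 _] <-]; apply: midpoint_defect_ge0.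
  exact: cons_family_norm.
have [//|d d0 dH] := H z0 _ f _ e0 fS.
exists d => // _ [zs [zs1 De] <-]; rewrite leNgt; apply/negP => zd.
move: De; rewrite leNgt => /negP; apply; apply: dH => //.
  exact: cons_family_norm.
by rewrite /gap /cons_family unlift_none eqxx.
Qed.

Lemma small_counterexample_seq (T : Type) (P : R -> T -> Prop) :
  (forall d, 0 < d -> exists t, P d t) ->
  exists t : nat -> T, forall n, P n.+1%:R^-1 (t n).
Proof.
move=> H; have /choice[t tP] : forall n : nat, exists t, P n.+1%:R^-1 t.
  by move=> n; apply: H; rewrite invr_gt0.
by exists t.
Qed.

(** Failure of the epsilon-delta form yields, for the tolerances [1/(n+1)], a sequence violating the
    sequential definition. Conversely, a vanishing gap makes the midpoint defect vanish too. *)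
Lemma k_WMLUR_rotund (Z : normedModType R) (k : nat) :
  k_WMLUR Z k <-> rotund Midpoint Z k.
Proof.
split=> H.
  move=> z0 eps f z01 e0 fS; have {}z01 : `|z0| = 1 by exact: z01.
  apply: contrapT => nd.
  have [z zP] : exists z : nat -> 'I_k.+1 -> Z, forall n,
      [/\ forall i, `|z n i| = 1, gap Midpoint z0 (z n) < n.+1%:R^-1 &
        eps <= `|Dk (z n) f|].
    apply: (@small_counterexample_seq _ (fun d z => [/\ forall i, `|z i| = 1,
      gap Midpoint z0 z < d & eps <= `|Dk z f|])) => d d0.
    apply: contrapT => nz; apply: nd; exists d => // z z1 _ zd.
    by rewrite ltNge; apply/negP => De; apply: nz; exists z.
  have /cvgr_dist_lt : (fun n => Dk (z n) f) @ \oo --> (0 : R).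
    apply: (H z0 (fun i n => z n i)) => //.
      by move=> i n; case: (zP n) => zn1 _ _; exact: zn1.
    apply: (@cvgr_dist0 _ _ _ _ harmonic); last exact: cvg_harmonic.
    apply: nearW => n; case: (zP n) => _ /ltW + _.
    by rewrite subr0 normr_id.
  move=> /(_ _ e0) /filter_ex[n].
  by rewrite sub0r normrN ltNge; case: (zP n) => _ _ ->.
move=> z0 zn z01 zn1 zncvg f fS; apply/cvgrPdist_lt => eps e0.
have [//|d d0 dH] := H z0 _ f _ e0 fS.
near=> n; rewrite sub0r normrN; apply: dH; first by move=> i; exact: zn1.
  (* As [z0] has norm 1, the triangle inequality bounds the defect by the gap divided by [k + 1]. *)
  apply: (@le_lt_trans _ _ (k.+1%:R^-1 * `|k.+1%:R *: z0 - \sum_i zn i n|)).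
    rewrite lerBlDr -mulrDr ler_pdivlMl// mulr1.
    have := ler_normD (k.+1%:R *: z0 - \sum_i zn i n) (\sum_i zn i n).
    by rewrite subrK normrZ z01 mulr1 ger0_norm.
  rewrite mulrC ltr_pdivrMr//; apply: (@lt_le_trans _ _ d).
    by near: n; exact: (cvgr_lt _ zncvg).
  by rewrite ler_pMr// ler1n.
by near: n; exact: (cvgr_lt _ zncvg).
Unshelve. all: by end_near. Qed.

Lemma Dk_cvg (Z : normedModType R) (k : nat) (U : set_system nat)
    (z : 'I_k.+1 -> nat -> Z) (f : 'I_k -> {linear Z -> R^o})
    (V : 'I_k -> 'I_k.+1 -> R) {FU : Filter U} :
  (forall j i, (fun n => (f j (z i n) : R)) @ U --> V j i) ->
  (fun n => Dk (z^~ n) f) @ U --> \det (diffmx V).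
Proof.
move=> fV; under eq_fun do rewrite Dk_diffmx.
apply: cvg_det => i j; under eq_fun do rewrite mxE.
by rewrite mxE; apply: cvgB.
Qed.

(** Counterexamples with tolerance [1/(n+1)] are aligned with [a = 1] along any ultrafilter refining
    the filter at infinity. Their determinants then tend to 0, although all are at least [eps] in
    absolute value. *)
Lemma limit_rotund_rotund (kd : kind) (Z : normedModType R) (k : nat) :
  limit_rotund kd Z k -> rotund kd Z k.
Proof.
move=> rZ z0 eps f z01 e0 fS; apply: contrapT => nd.
have [z zP] : exists z : nat -> 'I_k.+1 -> Z, forall n,
    [/\ forall i, `|z n i| = 1, midpoint_defect (z n) < n.+1%:R^-1,
      gap kd z0 (z n) < n.+1%:R^-1 & eps <= `|Dk (z n) f|].
  apply: (@small_counterexample_seq _ (fun d z => [/\ forall i, `|z i| = 1,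
    midpoint_defect z < d, gap kd z0 z < d & eps <= `|Dk z f|])) => d d0.
  apply: contrapT => nz; apply: nd; exists d => // z z1 zd zg.
  by rewrite ltNge; apply/negP => De; apply: nz; exists z.
have [U [FU sU]] := ultraFilterLemma (@eventually_filter).
have harm : (harmonic : nat -> R) @ U --> (0 : R).
  by move=> A /(@cvg_harmonic R) hA; exact: sU.
have z1 n i : `|z n i| = 1 by case: (zP n).
have za : aligned U (fun i n => z n i) 1.
  split=> [i|]; first by under eq_fun do rewrite z1; exact: cvg_cst.
  have E n : `|\sum_i z n i| = k.+1%:R * (1 - midpoint_defect (z n)).
    by rewrite /midpoint_defect subKr mulVKf ?pnatr_eq0.
  under eq_fun do rewrite E.
  apply: cvgM; first exact: cvg_cst.
  rewrite -[X in _ --> X]subr0; apply: cvgB; first exact: cvg_cst.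
  apply: cvgr_dist0 _ harm; apply: nearW => n; rewrite subr0 ger0_norm.
    by case: (zP n) => _ /ltW.
  exact: midpoint_defect_ge0.
have gap0 (y : 'I_k.+1 -> Z) : 0 <= gap kd z0 y.
  by case: (kd); rewrite /= ?lexx ?ler0n.
have zg : (fun n => gap kd z0 (z n)) @ U --> (0 : R).
  apply: cvgr_dist0 _ harm; apply: nearW => n; rewrite subr0 ger0_norm//.
  by case: (zP n) => _ _ /ltW.
have fc j : continuous (f j) by case: (fS j).
have /choice[V fV] : forall ji : 'I_k * 'I_k.+1, exists l : R,
    (fun n => (f ji.1 (z n ji.2) : R)) @ U --> l.
  move=> [j i]; apply: (@ultra_cvg_linear _ _ _ _ (f j) (fun n => z n i) 1) => //.
  by apply: nearW => n; rewrite z1.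
have fV' j i : (fun n => (f j (z n i) : R)) @ U --> V (j, i) := fV (j, i).
have D0 : (fun n => Dk (z n) f) @ U --> (0 : R).
  rewrite -(rZ U FU z0 1 _ za zg f fc _ fV').
  exact: (Dk_cvg (z := fun i n => z n i) fV').
move/cvgr_dist_lt : D0 => /(_ _ e0)/filter_ex[n].
by rewrite sub0r normrN ltNge; case: (zP n) => _ _ _ ->.
Qed.

(** Vectors and functionals are normalised so that the epsilon-delta form applies. The scalars taken
    out multiply the rows of the limit matrix; vanishing functionals and [a = 0], which cannot be
    normalised, are settled first. *)
Lemma rotund_limit_rotund (kd : kind) (Z : normedModType R) (k : nat) :
  (0 < k)%N -> rotund kd Z k -> limit_rotund kd Z k.
Proof.
move=> k0 rZ U FU z0 a z za zg f fc V fV.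
have a0 : 0 <= a by apply: (cvgr_to_ge (za.1 ord0)); exact: nearW.
have det_diag0 (c : 'I_k -> R) (A : 'M[R]_k) :
    diffmx V = diag_mx (\row_j c j) *m A -> \det A = 0 \/ (exists j, c j = 0) ->
    \det (diffmx V) = 0.
  move=> -> [A0|[j cj]]; rewrite det_mulmx; first by rewrite A0 mulr0.
  by rewrite det_diag (bigD1 j)//= mxE cj !mul0r.
(* A vanishing functional gives a zero row. *)
have [[j0 fj0]|nf0] := pselect (exists j, forall x, f j x = 0).
  apply: (det_diag0 (fun j => (j != j0)%:R) (diffmx V)); last first.
    by right; exists j0; rewrite eqxx.
  apply/matrixP => j i; rewrite mul_diag_mx !mxE.
  have [->|_] := eqVneq j j0; last by rewrite mul1r.
  have V0 l : V j0 l = 0.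
    apply: cvgr_inj (fV j0 l) _; under eq_fun do rewrite fj0.
    exact: cvg_cst.
  by rewrite !V0 subr0 mulr0.
have [az|anz] := eqVneq a 0.
  have V0 j l : V j l = 0.
    have [M M0 fM] := continuous_linear_norm_le (fc j).
    apply: cvgr_inj (fV j l) _.
    apply: (@cvgr_dist0 _ _ _ _ (fun n => M * `|z l n|)).
      by apply: nearW => n; rewrite subr0.
    rewrite -(mulr0 M); apply: cvgM; first exact: cvg_cst.
    by rewrite -az; exact: za.1.
  apply: (det_diag0 (fun=> 0) 0).
    by apply/matrixP => j i; rewrite mul_diag_mx !mxE !V0 subr0 mulr0.
  (* A zero matrix has determinant 0 only if it has a row, since the empty determinant is 1; [k0]
     provides one. *)
  by right; exists (Ordinal k0).
have apos : 0 < a by rewrite lt_def anz.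
have /choice[g] : forall j, exists gc : {linear Z -> R^o} * R,
    [/\ dual_unit_sphere gc.1, gc.2 != 0 & forall x, (f j x : R) = gc.2 * gc.1 x].
  move=> j; have [fj0|[g [c gcP]]] := dual_normalize (fc j).
    by exfalso; apply: nf0; exists j.
  by exists (g, c).
move=> /all_and3[gS cn0 fg].
(* Where [z i n] is 0 the inverse takes the default value 0 and [w i n] is not a unit vector. As
   [a > 0], this does not happen eventually along [U]. *)
pose w i n := `|z i n|^-1 *: z i n.
have wz i : (fun n => `|w i n - a^-1 *: z i n|) @ U --> (0 : R).
  have E n : `|w i n - a^-1 *: z i n| = `| `|z i n|^-1 - a^-1 | * `|z i n|.
    by rewrite -scalerBl normrZ.
  under eq_fun do rewrite E.
  rewrite -(mul0r a) -{1}(@normr0 _ R) -(subrr a^-1).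
  apply: cvgM; last exact: za.1.
  apply: cvg_norm; apply: cvgB; last exact: cvg_cst.
  by apply: cvgV => //; exact: za.1.
have swz : (fun n => `|\sum_i w i n - a^-1 *: \sum_i z i n|) @ U --> (0 : R).
  apply: (@cvgr_dist0 _ _ _ _ (fun n => \sum_i `|w i n - a^-1 *: z i n|)).
    apply: nearW => n; rewrite subr0 normr_id scaler_sumr -sumrB.
    exact: ler_norm_sum.
  have s0 : \sum_(i < k.+1) (0 : R) = 0 by rewrite big1.
  rewrite -[X in _ --> X]s0.
  by apply: (cvg_sumr (l := fun=> 0)) => i _; exact: wz.
have wd : (fun n => midpoint_defect (w^~ n)) @ U --> (0 : R).
  apply: (@cvgr_dist0 _ _ _ _ (fun n =>
    `|1 - k.+1%:R^-1 * (a^-1 * `|\sum_i z i n|)| +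
    k.+1%:R^-1 * `|\sum_i w i n - a^-1 *: \sum_i z i n|)).
    apply: nearW => n; rewrite subr0 /midpoint_defect.
    have := ler_dist_dist (\sum_i w i n) (a^-1 *: \sum_i z i n).
    rewrite normrZ (ger0_norm (_ : 0 <= a^-1)) ?invr_ge0// => D.
    set A := `|\sum_i w i n| in D *; set B := a^-1 * _ in D *.
    have -> : 1 - k.+1%:R^-1 * A = (1 - k.+1%:R^-1 * B) - k.+1%:R^-1 * (A - B).
      by ring.
    apply: le_trans (ler_normB _ _) _; rewrite lerD2l normrM ger0_norm//.
    by rewrite ler_wpM2l.
  rewrite -[X in _ --> X]addr0; apply: cvgD.
    rewrite -(@normr0 _ R); apply: cvg_norm.
    rewrite -[X in _ --> X](_ : 1 - k.+1%:R^-1 * (a^-1 * (k.+1%:R * a)) = 0).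
      apply: cvgB; first exact: cvg_cst.
      apply: cvgM; first exact: cvg_cst.
      by apply: cvgM; [exact: cvg_cst|exact: za.2].
    by rewrite (mulrCA a^-1) mulKf ?pnatr_eq0// mulVf// subrr.
  rewrite -(mulr0 k.+1%:R^-1); apply: cvgM => //; exact: cvg_cst.
(* The centre inherits the norm [a]: in the [Local] case it is eventually the first vector, in the
   [Midpoint] case [(k+1) z0] is the limit of the sums. Hence [a^-1 *: z0] is a unit vector. *)
have z0a : kd <> Uniform -> `|z0| = a.
  move: zg; case: (kd) => //= zg _.
    have : \forall n \near U, z ord0 n = z0.
      have zl : \forall n \near U, ((z ord0 n != z0)%:R : R) < 1.
        exact: (cvgr_lt _ zg _ ltr01).
      apply: filterS zl => n.
      by case: eqVneq => //= _; rewrite ltxx.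
    move=> zz; apply: cvgr_inj _ (za.1 ord0).
    apply: cvg_near_cst; apply: filterS zz => n ->//.
  have N0 : k.+1%:R != 0 :> R by rewrite pnatr_eq0.
  apply: (mulfI N0); apply: cvgr_inj _ za.2.
  have : (fun n => k.+1%:R * `|z0| - `|\sum_i z i n|) @ U --> (0 : R).
    apply: cvgr_dist0 _ zg; apply: nearW => n; rewrite subr0.
    have -> : k.+1%:R * `|z0| = `|k.+1%:R *: z0| by rewrite normrZ ger0_norm.
    exact: ler_dist_dist.
  move=> H; rewrite -[X in _ --> X]subr0.
  rewrite (_ : (fun n => _) = (fun n => k.+1%:R * `|z0| -
    (k.+1%:R * `|z0| - `|\sum_i z i n|))).
    by apply: cvgB => //; exact: cvg_cst.
  by apply/funext => n; rewrite subKr.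
have wg : (fun n => gap kd (a^-1 *: z0) (w^~ n)) @ U --> (0 : R).
  move: zg z0a; case: (kd) => /= zg z0a; first exact: cvg_cst.
    apply: cvgr_dist0 _ zg; apply: nearW => n; rewrite subr0 normr_nat ler_nat.
    have [zz0|_] := eqVneq (z ord0 n) z0; last by rewrite leq_b1.
    by rewrite /w zz0 z0a// eqxx.
  apply: (@cvgr_dist0 _ _ _ _ (fun n => a^-1 * `|k.+1%:R *: z0 - \sum_i z i n| +
    `|\sum_i w i n - a^-1 *: \sum_i z i n|)).
    apply: nearW => n; rewrite subr0 normr_id.
    have -> : a^-1 * `|k.+1%:R *: z0 - \sum_i z i n| =
        `|a^-1 *: (k.+1%:R *: z0 - \sum_i z i n)|.
      by rewrite normrZ ger0_norm ?invr_ge0.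
    apply: le_trans (ler_normB _ _).
    by rewrite scalerBr !scalerA (mulrC a^-1) opprB addrA subrK.
  rewrite -[X in _ --> X]addr0; apply: cvgD => //.
  rewrite -(mulr0 a^-1); apply: cvgM => //; exact: cvg_cst.
pose V' j i := a^-1 * ((g j).2^-1 * V j i).
have gV' j i : (fun n => ((g j).1 (w i n) : R)) @ U --> V' j i.
  rewrite (_ : (fun n => _) =
    (fun n => `|z i n|^-1 * ((g j).2^-1 * (f j (z i n) : R)))).
    apply: cvgM; first by apply: cvgV => //; exact: za.1.
    by apply: cvgM; [exact: cvg_cst|exact: fV].
  by apply/funext => n; rewrite /w linearZ/= fg mulKf.
have Dw : (fun n => Dk (w^~ n) (fun j => (g j).1)) @ U --> \det (diffmx V').
  exact: Dk_cvg.
(* For each [e > 0], the normalised vectors eventually meet the tolerance [d] attached to [e], so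
   the limit is at most [e] in absolute value. *)
have Dw0 : \det (diffmx V') = 0.
  apply/eqP; rewrite -normr_le0; apply/ler_addgt0Pl => e e0; rewrite addr0.
  apply: (cvgr_to_le (cvg_norm Dw)).
  have [|d d0 dH] := rZ (a^-1 *: z0) e (fun j => (g j).1) _ e0 gS.
    by move=> /z0a z0a'; rewrite normrZ z0a' ger0_norm ?invr_ge0// mulVf.
  near=> n; apply/ltW/dH.
  - move=> i; have zi0 : `|z i n| != 0.
      rewrite gt_eqF//; move: i.
      near: n; apply: filter_forall => i.
      exact: (cvgr_gt _ (za.1 i)).
    by rewrite /w normrZ normfV normr_id mulVf.
  - by near: n; exact: (cvgr_lt _ wd).
  - by near: n; exact: (cvgr_lt _ wg).
(* Undoing the normalisation multiplies row [j] by [a] and by the norming constant of [f j]. *)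
apply: (det_diag0 (fun j => a * (g j).2) (diffmx V')); last by left.
apply/matrixP => j i; rewrite mul_diag_mx !mxE /V'.
by field; rewrite anz cn0.
Unshelve. all: by end_near. Qed.

End EpsilonDelta.

Theorem theorem4p12 (R : realType) (X Y : completeNormedModType R)
    (p : R) (hp : 1 < p) (k1 k2 k : nat)
    (hk1 : (0 < k1)%N) (hk2 : (0 < k2)%N) (hk0 : (0 < k)%N)
    (hk : k = (k1 + k2 - 1)%N) :
  (k_WUR X k1 -> k_WUR Y k2 -> k_WUR (lpsum hp X Y) k) /\
  (k_WLUR X k1 -> k_WLUR Y k2 -> k_WLUR (lpsum hp X Y) k) /\
  (k_WMLUR X k1 -> k_WMLUR Y k2 -> k_WMLUR (lpsum hp X Y) k).
Proof.
have main kd : rotund kd X k1 -> rotund kd Y k2 -> rotund kd (lpsum hp X Y) k.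
  move=> /(rotund_limit_rotund hk1) rX /(rotund_limit_rotund hk2) rY.
  by apply: limit_rotund_rotund; exact: limit_rotund_lpsum rX rY.
split; [|split].
- by move=> /k_WUR_rotund rX /k_WUR_rotund rY; apply/k_WUR_rotund; exact: main.
- by move=> /k_WLUR_rotund rX /k_WLUR_rotund rY; apply/k_WLUR_rotund; exact: main.
- by move=> /k_WMLUR_rotund rX /k_WMLUR_rotund rY; apply/k_WMLUR_rotund; exact: main.
Qed.
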